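(* Let $Q\in\mathbb R^{n\times n}$ be a symmetric irreducible loopy Laplacian, let $\alpha=\{1,\dots,|\alpha|\}$ with $2\le|\alpha|<n$ be the set of boundary nodes, and let $Q_{\mathrm{red}}=Q/Q(\alpha,\alpha)=Q[\alpha,\alpha]-Q[\alpha,\alpha)\,Q(\alpha,\alpha)^{-1}\,Q(\alpha,\alpha]$ be the Kron-reduced matrix. Let $R_{ij}=(e_i-e_j)^TQ^{\dagger}(e_i-e_j)$ for $i,j\in\{1,\dots,n\}$ be the effective resistances. Then: 1) (Invariance under Kron reduction) For all $i,j\in\alpha$, $$R_{ij}=(e_i-e_j)^TQ^{\dagger}(e_i-e_j)=(e_i-e_j)^TQ_{\mathrm{red}}^{\dagger}(e_i-e_j),$$ where on the right $e_i,e_j$ denote the standard basis vectors of $\mathbb R^{|\alpha|}$. 2) (Invariance under augmentation) If $Q$ is strictly loopy, then for all $i,j\in\{1,\dots,n\}$, $$R_{ij}=(e_i-e_j)^TQ^{-1}(e_i-e_j)=(e_i-e_j)^T\widehat Q^{\dagger}(e_i-e_j),$$ where on the right $e_i,e_j\in\mathbb R^{n+1}$ and $\widehat Q$ is the augmented Laplacian of $Q$. 3) (Effect of self-loops) If $Q$ is strictly loopy, $L$ is the corresponding loop-less Laplacian and $\bar R_{ij}=(e_i-e_j)^TL^{\dagger}(e_i-e_j)$, then $R_{ij}\le\bar R_{ij}$ for all $i,j\in\{1,\dots,n\}$.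
   Context: A loopy Laplacian is built from a symmetric matrix $A\in\mathbb R^{n\times n}$ with $A_{ij}=A_{ji}\ge0$ (off-diagonal entries are edge weights, diagonal entries $A_{ii}\ge 0$ are self-loop weights): $Q_{ij}=-A_{ij}$ for $i\ne j$ and $Q_{ii}=\sum_{j\neq i}A_{ij}+A_{ii}$. The corresponding loop-less Laplacian is $L=Q-\mathrm{diag}(A_{11},\dots,A_{nn})$. $Q$ is irreducible if the graph on $\{1,\dots,n\}$ with an edge $\{i,j\}$ whenever $i\ne j$ and $A_{ij}>0$ is connected; $Q$ is loop-less if all $A_{ii}=0$ and strictly loopy if some $A_{ii}>0$ (then $Q$ is invertible). $^{\dagger}$ denotes the Moore–Penrose pseudoinverse. For the index set $\alpha$ of boundary nodes (the first $|\alpha|$ indices; the remaining ones are interior nodes), $Q[\alpha,\alpha]$ is the submatrix with rows and columns in $\alpha$, $Q(\alpha,\alpha)$ the submatrix with rows and columns in the complement of $\alpha$, $Q[\alpha,\alpha)$ rows in $\alpha$ and columns in the complement, $Q(\alpha,\alpha]=Q[\alpha,\alpha)^T$; for irreducible $Q$, $Q(\alpha,\alpha)$ is invertible. The augmented Laplacian is the $(n+1)\times(n+1)$ loop-less Laplacian $\widehat Q=\begin{bmatrix}Q&-a\\-a^T&\sum_i a_i\end{bmatrix}$ with $a=(A_{11},\dots,A_{nn})^T$, i.e. self-loops are replaced by edges to an additional grounded node $n+1$. *)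

(* Defs.v *)
From HB Require Import structures.
From mathcomp Require Import all_boot all_order all_algebra.
From mathcomp Require Import boolp classical_sets reals.

Set Implicit Arguments.
Unset Strict Implicit.
Unset Printing Implicit Defensive.

Import Order.TTheory GRing.Theory Num.Theory.
Local Open Scope ring_scope.

Section MoorePenrose.
Variable R : realType.

Definition moore_penrose (m n : nat) (M : 'M[R]_(m, n)) (X : 'M[R]_(n, m)) : Prop :=
  [/\ M *m X *m M = M, X *m M *m X = X,
      (M *m X)^T = M *m X & (X *m M)^T = X *m M].

(* MathComp's [pinvmx] is only a generalized inverse (it need not satisfy the
   two symmetry conditions).  The default 0 is never used, by [mpinvP]. *)
Definition mpinv (m n : nat) (M : 'M[R]_(m, n)) : 'M[R]_(n, m) :=
  xget 0 [set X | moore_penrose M X]%classic.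

Lemma moore_penrose_uniq m n (M : 'M[R]_(m, n)) X Y :
  moore_penrose M X -> moore_penrose M Y -> X = Y.
Proof.
move=> [mxm xmx smx sxm] [mym ymy smy sym].
have eM : M *m X = M *m Y.
  by rewrite -smx -{1}mym -mulmxA trmx_mul smx smy !mulmxA mxm.
have eX : X *m M = Y *m M.
  by rewrite -sxm -{1}mym -mulmxA mulmxA trmx_mul sxm sym -mulmxA (mulmxA M) mxm.
by rewrite -xmx -mulmxA eM mulmxA eX.
Qed.

Lemma row_free_gram m n (F : 'M[R]_(m, n)) : row_free F -> F *m F^T \in unitmx.
Proof.
move=> fF; rewrite -row_free_unit -kermx_eq0; apply/eqP/row_matrixP => i.
rewrite row0; set v := row i _.
have v0 : v *m (F *m F^T) = 0 by apply/sub_kermxP/row_sub.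
suff vF0 : v *m F = 0.
  by apply: (row_free_inj fF); rewrite vF0 mul0mx.
have : ((v *m F) *m (v *m F)^T) 0 0 = 0.
  by rewrite trmx_mul !mulmxA -(mulmxA v) v0 mul0mx mxE.
rewrite mxE; set w := v *m F => ww0.
have ww0' : \sum_j w 0 j ^+ 2 = 0.
  by rewrite -[RHS]ww0; apply: eq_bigr => j _; rewrite [X in _ * X]mxE expr2.
apply/rowP => j; rewrite [RHS]mxE; apply/eqP; rewrite -sqrf_eq0; apply/eqP.
by apply: (psumr_eq0P _ ww0') => // l _; exact: sqr_ge0.
Qed.

Lemma moore_penrose_ex m n (M : 'M[R]_(m, n)) : exists X, moore_penrose M X.
Proof.
have [r [C [F [defM uF uC]]]] : exists r (C : 'M[R]_(m, r)) (F : 'M[R]_(r, n)),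
    [/\ M = C *m F, F *m F^T \in unitmx & C^T *m C \in unitmx].
  exists (\rank M), (col_base M), (row_base M); split.
  - by rewrite mulmx_base.
  - by apply/row_free_gram/row_base_free.
  - rewrite -[X in _ *m X]trmxK; apply: row_free_gram.
    by rewrite /row_free mxrank_tr; exact: col_base_full.
exists (F^T *m invmx (F *m F^T) *m (invmx (C^T *m C) *m C^T)).
set X := (X in moore_penrose _ X).
have eM : M *m X = C *m (invmx (C^T *m C) *m C^T).
  by rewrite defM /X -!mulmxA (mulmxA F) (mulmxA (F *m _)) mulmxV // mul1mx.
have eX : X *m M = F^T *m invmx (F *m F^T) *m F.
  by rewrite defM /X -!mulmxA (mulmxA C^T) (mulmxA (invmx (C^T *m _))) mulVmx // mul1mx.
split.
- by rewrite eM defM -!mulmxA (mulmxA C^T) (mulmxA (invmx _)) mulVmx // mul1mx.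
- by rewrite eX /X -!mulmxA (mulmxA F) (mulmxA (F *m _)) mulmxV // mul1mx.
- by rewrite eM !trmx_mul trmxK trmx_inv trmx_mul trmxK mulmxA.
- by rewrite eX !trmx_mul trmxK trmx_inv trmx_mul trmxK mulmxA.
Qed.

Lemma mpinvP m n (M : 'M[R]_(m, n)) : moore_penrose M (mpinv M).
Proof. by have [X XP] := moore_penrose_ex M; exact: (xgetI 0 XP). Qed.

End MoorePenrose.

Section Laplacian.
Variable R : realType.

Definition weight_matrix (n : nat) (A : 'M[R]_n) : Prop :=
  (forall i j, A i j = A j i) /\ (forall i j, 0 <= A i j).

Definition loopy_laplacian (n : nat) (A : 'M[R]_n) : 'M[R]_n :=
  \matrix_(i, j) if i == j then \sum_(l | l != i) A i l + A i i else - A i j.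

Definition self_loops (n : nat) (A : 'M[R]_n) : 'cV[R]_n := \col_i A i i.

Definition loopless_laplacian (n : nat) (A : 'M[R]_n) : 'M[R]_n :=
  loopy_laplacian A - diag_mx (self_loops A)^T.

Definition weight_edge (n : nat) (A : 'M[R]_n) : rel 'I_n :=
  fun i j => (i != j) && (0 < A i j).

Definition irreducible_laplacian (n : nat) (A : 'M[R]_n) : Prop :=
  forall i j : 'I_n, connect (weight_edge A) i j.

Definition strictly_loopy (n : nat) (A : 'M[R]_n) : Prop :=
  exists i : 'I_n, 0 < A i i.

Definition augmented_laplacian (n : nat) (A : 'M[R]_n) : 'M[R]_(n + 1) :=
  block_mx (loopy_laplacian A) (- self_loops A)
           (- (self_loops A)^T) (\sum_i A i i)%:M.

(* The boundary nodes are the first [k] of the [k + m] indices. *)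
Definition kron_reduction (k m : nat) (Q : 'M[R]_(k + m)) : 'M[R]_k :=
  ulsubmx Q - ursubmx Q *m invmx (drsubmx Q) *m dlsubmx Q.

Definition basis_vec (n : nat) (i : 'I_n) : 'cV[R]_n := delta_mx i 0.

Definition diff_form (n : nat) (M : 'M[R]_n) (i j : 'I_n) : R :=
  ((basis_vec i - basis_vec j)^T *m M *m (basis_vec i - basis_vec j)) 0 0.

Definition eff_resistance (n : nat) (Q : 'M[R]_n) (i j : 'I_n) : R :=
  diff_form (mpinv Q) i j.

End Laplacian.

(* Main.v *)
Require Import Defs.
From HB Require Import structures.
From mathcomp Require Import all_boot all_order all_algebra.
From mathcomp Require Import boolp classical_sets reals.
From mathcomp Require Import ring lra.

Set Implicit Arguments.
Unset Strict Implicit.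
Unset Printing Implicit Defensive.

Import Order.TTheory GRing.Theory Num.Theory.
Local Open Scope ring_scope.

(** If M is symmetric and M x = e_i - e_j, then
    (e_i - e_j)^T M^dagger (e_i - e_j) = x^T M M^dagger M x = x_i - x_j,
    so an effective resistance is a potential difference of any solution x of
    Kirchhoff's equations.  Such an x exists for an irreducible loopy Laplacian,
    because w^T Q w = 1/2 sum A_ij (w_i - w_j)^2 + sum A_ii w_i^2 forces the
    kernel to consist of constant vectors.  The three claims then compare
    solutions: the boundary part of x solves the Kron-reduced equations; x padded
    by 0 at the ground solves the augmented ones; and, for L y = e_i - e_j, the
    bound follows from (x - y)^T L (x - y) >= 0 and x^T L x <= x^T Q x. *)

Section EffectiveResistance.
Variable R : realType.

(** * Effective resistance as a potential difference *)

Definition quad_form n (M : 'M[R]_n) (w : 'cV[R]_n) : R := (w^T *m M *m w) 0 0.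

Lemma mulmx_trE n (u v : 'cV[R]_n) : (u^T *m v) 0 0 = \sum_i u i 0 * v i 0.
Proof. by rewrite mxE; apply: eq_bigr => i _; rewrite mxE. Qed.

Lemma mulmx_tr_basis_diff n (x : 'cV[R]_n) i j :
  (x^T *m (basis_vec R i - basis_vec R j)) 0 0 = x i 0 - x j 0.
Proof. by rewrite mulmxBr -!colE !mxE. Qed.

(** [kermx] is the left kernel; transposing its rows and using symmetry moves them to the right
    kernel. *)
Lemma unitmx_of_ker0 n (M : 'M[R]_n) : M^T = M ->
  (forall w : 'cV[R]_n, M *m w = 0 -> w = 0) -> M \in unitmx.
Proof.
move=> sM ker0; rewrite -row_free_unit -kermx_eq0.
apply/eqP/row_matrixP => i; rewrite row0; set v := row i _.
have v0 : v *m M = 0 by apply/sub_kermxP/row_sub.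
by rewrite -[v]trmxK [v^T]ker0 ?trmx0 // -{1}sM -trmx_mul v0 trmx0.
Qed.

Lemma eff_resistanceE n (M : 'M[R]_n) (x : 'cV[R]_n) i j : M^T = M ->
  M *m x = basis_vec R i - basis_vec R j -> eff_resistance M i j = x i 0 - x j 0.
Proof.
move=> sM Mx; have [MXM _ _ _] := mpinvP M.
rewrite /eff_resistance /diff_form -{1 2}Mx trmx_mul sM.
by rewrite -!mulmxA (mulmxA M) (mulmxA _ M x) MXM Mx mulmx_tr_basis_diff.
Qed.

(* The residual w = b - M M^dagger b is in the kernel of M and orthogonal to
   the range of M, hence w^T w = w^T b = w_i - w_j. *)
Lemma mul_mpinv_basis_diff n (M : 'M[R]_n) i j : M^T = M ->
  (forall w : 'cV[R]_n, M *m w = 0 -> w i 0 = w j 0) ->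
  M *m (mpinv M *m (basis_vec R i - basis_vec R j)) =
    basis_vec R i - basis_vec R j.
Proof.
move=> sM kerM; have [MXM _ sMX _] := mpinvP M.
set b := _ - _; set w := b - M *m (mpinv M *m b).
have Mw : M *m w = 0.
  (* Transpose of M X M = M, where X is [mpinv M], since both M and M X are symmetric. *)
  have MMX : M *m (M *m mpinv M) = M by rewrite -{1}sM -sMX -trmx_mul MXM.
  by rewrite mulmxBr (mulmxA M (mpinv M)) (mulmxA M (M *m _)) MMX subrr.
have ww0 : (w^T *m w) 0 0 = 0.
  have wM : w^T *m M = 0 by rewrite -[LHS]trmxK trmx_mul trmxK sM Mw trmx0.
  rewrite {2}/w mulmxBr (mulmxA w^T) wM mul0mx subr0.
  by rewrite mulmx_tr_basis_diff kerM // subrr.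
suff w0 : w = 0 by apply/esym/eqP; rewrite -subr_eq0 -/w w0.
apply/colP => l; rewrite [RHS]mxE; apply/eqP; rewrite -sqrf_eq0; apply/eqP.
rewrite mulmx_trE in ww0.
by apply: (psumr_eq0P _ ww0) => // s _; rewrite -expr2 sqr_ge0.
Qed.

Lemma quad_form_basis_diff n (M : 'M[R]_n) (x : 'cV[R]_n) i j :
  M *m x = basis_vec R i - basis_vec R j -> quad_form M x = x i 0 - x j 0.
Proof. by move=> Mx; rewrite /quad_form -mulmxA Mx mulmx_tr_basis_diff. Qed.

(** * Energy of a loopy Laplacian and its kernel *)

Lemma loopy_laplacian_tr n (A : 'M[R]_n) : weight_matrix A ->
  (loopy_laplacian A)^T = loopy_laplacian A.
Proof.
move=> [sA _]; apply/matrixP => i j; rewrite !mxE eq_sym.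
by case: eqVneq => [->//|_]; rewrite sA.
Qed.

Lemma loopy_laplacian_mul n (A : 'M[R]_n) (w : 'cV[R]_n) i :
  (loopy_laplacian A *m w) i 0 =
    \sum_l A i l * (w i 0 - w l 0) + A i i * w i 0.
Proof.
rewrite mxE (bigD1 i) //= mxE eqxx [in RHS](bigD1 i) //= subrr mulr0 add0r.
rewrite mulrDl mulr_suml addrAC; congr (_ + _); rewrite -big_split /=.
apply: eq_bigr => l li; rewrite mxE eq_sym (negPf li); ring.
Qed.

Lemma loopy_laplacian_energy n (A : 'M[R]_n) (w : 'cV[R]_n) : weight_matrix A ->
  2 * quad_form (loopy_laplacian A) w =
    \sum_i \sum_l A i l * (w i 0 - w l 0) ^+ 2
      + 2 * \sum_i A i i * w i 0 ^+ 2.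
Proof.
move=> [sA _]; rewrite /quad_form -mulmxA mulmx_trE.
under eq_bigr do rewrite loopy_laplacian_mul mulrDr.
rewrite big_split /= mulrDr; congr (_ + _); last first.
  by congr (_ * _); apply: eq_bigr => i _; ring.
rewrite mulr_natl mulr2n.
under eq_bigr do rewrite mulr_sumr.
(* Swapping the two indices in one of the two copies pairs A_il w_i (w_i - w_l) with A_li w_l (w_l -
   w_i); by symmetry of A they add up to a square. *)
rewrite {2}exchange_big -big_split /=; apply: eq_bigr => i _.
by rewrite -big_split /=; apply: eq_bigr => l _; rewrite (sA l i); ring.
Qed.

Lemma energy_ge0 n (A : 'M[R]_n) (w : 'cV[R]_n) : weight_matrix A ->
  0 <= \sum_i \sum_l A i l * (w i 0 - w l 0) ^+ 2 /\
  0 <= \sum_i A i i * w i 0 ^+ 2.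
Proof.
move=> [_ A0]; split; last by apply: sumr_ge0 => i _; rewrite mulr_ge0 ?sqr_ge0.
by do 2![apply: sumr_ge0 => ? _]; rewrite mulr_ge0 ?sqr_ge0.
Qed.

Lemma loopy_laplacian_psd n (A : 'M[R]_n) (w : 'cV[R]_n) : weight_matrix A ->
  0 <= quad_form (loopy_laplacian A) w.
Proof.
move=> hA; have [] := energy_ge0 w hA; have := loopy_laplacian_energy w hA.
lra.
Qed.

(** Zero energy makes each nonnegative term vanish, so w agrees across every edge, and connectivity
    carries the common value along paths. *)
Lemma quad_form0_const n (A : 'M[R]_n) (w : 'cV[R]_n) : weight_matrix A ->
  irreducible_laplacian A -> quad_form (loopy_laplacian A) w = 0 ->
  forall i j, w i 0 = w j 0.
Proof.
move=> hA hirr q0; have [e1 e2] := energy_ge0 w hA.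
have := loopy_laplacian_energy w hA; rewrite q0 => eE.
have {e2}E0 : \sum_i \sum_l A i l * (w i 0 - w l 0) ^+ 2 = 0 by lra.
have [_ A0] := hA.
have edge i j : weight_edge A i j -> w i 0 = w j 0.
  case/andP=> _ Aij; apply/eqP; rewrite -subr_eq0 -sqrf_eq0.
  have := psumr_eq0P _ E0 => /(_ _ i isT) Ei.
  have {}Ei : \sum_l A i l * (w i 0 - w l 0) ^+ 2 = 0.
    by apply: Ei => s _; apply: sumr_ge0 => l _; rewrite mulr_ge0 ?sqr_ge0.
  have Eij : A i j * (w i 0 - w j 0) ^+ 2 = 0.
    by apply: (psumr_eq0P _ Ei) => // l _; rewrite mulr_ge0 ?sqr_ge0.
  by move/eqP: Eij; rewrite mulf_eq0 gt_eqF.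
move=> i j; have /connectP[p] := hirr i j.
elim: p i => [|l p IHp] i /=; first by move=> _ ->.
by case/andP=> /edge -> pl /(IHp _ pl).
Qed.

(** The constant value of w is 0 because the term of a positive self-loop vanishes too. *)
Lemma quad_form0_eq0 n (A : 'M[R]_n) (w : 'cV[R]_n) : weight_matrix A ->
  irreducible_laplacian A -> strictly_loopy A ->
  quad_form (loopy_laplacian A) w = 0 -> w = 0.
Proof.
move=> hA hirr [s As] q0; have wc := quad_form0_const hA hirr q0.
have [e1 e2] := energy_ge0 w hA; have := loopy_laplacian_energy w hA.
rewrite q0 => eE; have E0 : \sum_i A i i * w i 0 ^+ 2 = 0 by lra.
have [_ A0] := hA.
have /eqP : A s s * w s 0 ^+ 2 = 0.
  by apply: (psumr_eq0P _ E0) => // i _; rewrite mulr_ge0 ?sqr_ge0.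
rewrite mulf_eq0 gt_eqF //= sqrf_eq0 => /eqP ws.
by apply/colP => i; rewrite (wc i s) ws mxE.
Qed.

Lemma quad_form_ker n (M : 'M[R]_n) (w : 'cV[R]_n) :
  M *m w = 0 -> quad_form M w = 0.
Proof. by move=> Mw; rewrite /quad_form -mulmxA Mw mulmx0 mxE. Qed.

(** * Solvability of Kirchhoff's equations and invertibility *)

Lemma loopy_laplacian_solve n (A : 'M[R]_n) i j : weight_matrix A ->
  irreducible_laplacian A ->
  exists x, loopy_laplacian A *m x = basis_vec R i - basis_vec R j.
Proof.
move=> hA hirr; eexists; apply: mul_mpinv_basis_diff.
  exact: loopy_laplacian_tr.
by move=> w /quad_form_ker q0; exact: (quad_form0_const hA hirr q0).
Qed.

Lemma loopy_laplacian_unit n (A : 'M[R]_n) : weight_matrix A ->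
  irreducible_laplacian A -> strictly_loopy A -> loopy_laplacian A \in unitmx.
Proof.
move=> hA hirr hs; apply: unitmx_of_ker0; first exact: loopy_laplacian_tr.
by move=> w /quad_form_ker; exact: quad_form0_eq0.
Qed.

(** A kernel vector of the interior block, extended by 0 to the boundary, has zero energy, hence is
    constant and equal to its boundary value 0. *)
Lemma interior_block_unit k m (A : 'M[R]_(k + m)) : (0 < k)%N ->
  weight_matrix A -> irreducible_laplacian A ->
  drsubmx (loopy_laplacian A) \in unitmx.
Proof.
move=> k0 hA hirr; set Q := loopy_laplacian A.
apply: unitmx_of_ker0; first by rewrite trmx_drsub loopy_laplacian_tr.
move=> w Qw; set z : 'cV[R]_(k + m) := col_mx 0 w.
have q0 : quad_form Q z = 0.
  rewrite /quad_form -mulmxA -[Q]submxK mul_block_col !mulmx0 !add0r Qw.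
  by rewrite tr_col_mx mul_row_col trmx0 mul0mx mulmx0 addr0 mxE.
apply/colP => l; have := quad_form0_const hA hirr q0 (rshift k l) (lshift m (Ordinal k0)).
by rewrite col_mxEd col_mxEu !mxE.
Qed.

(** * Kron reduction as block elimination *)

Lemma kron_reduction_tr k m (Q : 'M[R]_(k + m)) : Q^T = Q ->
  (kron_reduction Q)^T = kron_reduction Q.
Proof.
move=> sQ; rewrite /kron_reduction linearB /= !trmx_mul trmx_inv.
by rewrite trmx_ulsub trmx_drsub trmx_dlsub trmx_ursub sQ mulmxA.
Qed.

(** With no current injected at interior nodes, the lower block row determines the interior
    potentials; substituting them into the upper row leaves the Schur complement. *)
Lemma kron_reduction_mul k m (Q : 'M[R]_(k + m)) (x : 'cV[R]_(k + m)) b :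
  drsubmx Q \in unitmx -> Q *m x = col_mx b 0 ->
  kron_reduction Q *m usubmx x = b.
Proof.
move=> uQ; rewrite -{1}[Q]submxK -{1}[x]vsubmxK mul_block_col.
case/eq_col_mx => eb e0; rewrite /kron_reduction mulmxBl -!mulmxA.
rewrite (_ : dlsubmx Q *m usubmx x = - (drsubmx Q *m dsubmx x)); last first.
  by apply/eqP; rewrite -addr_eq0 e0.
by rewrite !mulmxN (mulmxA (invmx _)) mulVmx // mul1mx opprK.
Qed.

(** No current enters the added indices; these are the interior nodes in Kron reduction and the
    ground in augmentation. *)
Lemma basis_diff_lshift k m (i j : 'I_k) :
  basis_vec R (lshift m i) - basis_vec R (lshift m j) =
    col_mx (basis_vec R i - basis_vec R j) 0.
Proof.
apply/colP => l; rewrite -[l]splitK; case: (split l) => s /=.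
  by rewrite col_mxEu !mxE !(inj_eq (@lshift_inj _ _)).
by rewrite col_mxEd !mxE !eq_rlshift subrr.
Qed.

(** * Augmentation by a grounded node *)

Lemma augmented_laplacian_tr n (A : 'M[R]_n) : weight_matrix A ->
  (augmented_laplacian A)^T = augmented_laplacian A.
Proof.
move=> hA; rewrite /augmented_laplacian tr_block_mx loopy_laplacian_tr //.
by rewrite !linearN /= trmxK tr_scalar_mx.
Qed.

(** A constant potential drives no current through edges, only through self-loops. *)
Lemma loopy_laplacian_mul1 n (A : 'M[R]_n) :
  loopy_laplacian A *m const_mx 1 = self_loops A.
Proof.
apply/colP => i; rewrite loopy_laplacian_mul big1 ?add0r => [|l _].
  by rewrite !mxE mulr1.
by rewrite !mxE subrr mulr0.
Qed.

(* The current into the ground is a^T x = 1^T Q x = 1^T (e_i - e_j) = 0. *)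
Lemma augmented_laplacian_mul n (A : 'M[R]_n) (x : 'cV[R]_n) i j :
  weight_matrix A ->
  loopy_laplacian A *m x = basis_vec R i - basis_vec R j ->
  augmented_laplacian A *m col_mx x 0 =
    basis_vec R (lshift 1 i) - basis_vec R (lshift 1 j).
Proof.
move=> hA Qx; rewrite mul_block_col !mulmx0 !addr0 basis_diff_lshift Qx.
congr col_mx; rewrite mulNmx -loopy_laplacian_mul1 trmx_mul.
rewrite loopy_laplacian_tr // -mulmxA Qx; apply/colP => l.
by rewrite ord1 [LHS]mxE mulmx_tr_basis_diff !mxE subrr oppr0.
Qed.

(** * Effect of self-loops *)

Definition remove_loops n (A : 'M[R]_n) : 'M[R]_n :=
  \matrix_(i, j) if i == j then 0 else A i j.

(** Makes the energy and solvability results available for L. *)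
Lemma loopless_laplacianE n (A : 'M[R]_n) :
  loopless_laplacian A = loopy_laplacian (remove_loops A).
Proof.
apply/matrixP => i j; rewrite !mxE; case: eqVneq => [->|ij] /=.
  rewrite eqxx mulr1n addrK addr0; apply: eq_bigr => l li.
  by rewrite mxE eq_sym (negPf li).
by rewrite mulr0n subr0.
Qed.

Lemma remove_loops_weight n (A : 'M[R]_n) :
  weight_matrix A -> weight_matrix (remove_loops A).
Proof.
by move=> [sA A0]; split=> i j; rewrite !mxE; [rewrite eq_sym sA | case: ifP].
Qed.

Lemma remove_loops_irreducible n (A : 'M[R]_n) :
  irreducible_laplacian A -> irreducible_laplacian (remove_loops A).
Proof.
move=> hirr i j; rewrite (@eq_connect _ _ (weight_edge A)) // => s t.
by rewrite /weight_edge mxE; case: eqVneq.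
Qed.

(** The two forms differ by the sum of A_ii x_i^2. *)
Lemma quad_form_loopless_le n (A : 'M[R]_n) (x : 'cV[R]_n) : weight_matrix A ->
  quad_form (loopless_laplacian A) x <= quad_form (loopy_laplacian A) x.
Proof.
move=> [_ A0]; rewrite /quad_form /loopless_laplacian mulmxBr mulmxBl [leLHS]mxE gerDl.
rewrite [leLHS]mxE oppr_le0 -mulmxA mulmx_trE; apply: sumr_ge0 => i _.
by rewrite mul_diag_mx !mxE mulrCA -expr2 mulr_ge0 ?sqr_ge0.
Qed.

Lemma quad_formB n (M : 'M[R]_n) (x y : 'cV[R]_n) : M^T = M ->
  quad_form M (x - y) =
    quad_form M x - 2 * (x^T *m (M *m y)) 0 0 + quad_form M y.
Proof.
move=> sM; rewrite /quad_form [(x - y)^T]linearB /= !(mulmxBl, mulmxBr).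
(* A 1 x 1 matrix equals its transpose, so the two cross terms agree. *)
have -> : y^T *m M *m x = x^T *m (M *m y).
  by rewrite -[LHS]trmxK [y^T *m M *m x]mx11_scalar tr_scalar_mx -mx11_scalar
    !trmx_mul trmxK sM.
rewrite -!mulmxA !mxE; ring.
Qed.

Lemma eff_resistance_loopless_le n (A : 'M[R]_n) i j : weight_matrix A ->
  irreducible_laplacian A ->
  eff_resistance (loopy_laplacian A) i j
    <= eff_resistance (loopless_laplacian A) i j.
Proof.
move=> hA hirr; have hA' := remove_loops_weight hA.
have hirr' := remove_loops_irreducible hirr.
have [x Qx] := loopy_laplacian_solve i j hA hirr.
have [y Ly] := loopy_laplacian_solve i j hA' hirr'.
have sL := loopy_laplacian_tr hA'.
have := quad_form_loopless_le x hA; rewrite loopless_laplacianE.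
rewrite (eff_resistanceE (loopy_laplacian_tr hA) Qx) (eff_resistanceE sL Ly).
have := loopy_laplacian_psd (x - y) hA'; rewrite (quad_formB x y sL) Ly.
rewrite mulmx_tr_basis_diff (quad_form_basis_diff Qx) (quad_form_basis_diff Ly).
(* With r = x_i - x_j and s = y_i - y_j, the facts at hand read 0 <= x^T L x - 2 r + s and x^T L x
   <= r, whence r <= s. *)
lra.
Qed.

(** * Invariance of effective resistances *)

Lemma eff_resistance_kron k m (A : 'M[R]_(k + m)) (i j : 'I_k) :
  weight_matrix A -> irreducible_laplacian A ->
  eff_resistance (loopy_laplacian A) (lshift m i) (lshift m j) =
    eff_resistance (kron_reduction (loopy_laplacian A)) i j.
Proof.
move=> hA hirr; have sQ := loopy_laplacian_tr hA.
have k0 : (0 < k)%N := leq_ltn_trans (leq0n i) (ltn_ord i).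
have [x Qx] := loopy_laplacian_solve (lshift m i) (lshift m j) hA hirr.
have Qb := Qx; rewrite basis_diff_lshift in Qb.
have Qred := kron_reduction_mul (interior_block_unit k0 hA hirr) Qb.
rewrite (eff_resistanceE sQ Qx) (eff_resistanceE (kron_reduction_tr sQ) Qred).
by rewrite !mxE.
Qed.

Lemma eff_resistance_invmx n (M : 'M[R]_n) i j : M^T = M -> M \in unitmx ->
  eff_resistance M i j = diff_form (invmx M) i j.
Proof.
move=> sM uM; have [MXM _ _ _] := mpinvP M.
rewrite /eff_resistance; congr diff_form.
(* Cancelling M on both sides of M X M = M forces X to be the inverse. *)
by rewrite -[LHS](mulKmx uM) -[M *m _](mulmxK uM) MXM mulmxV // mulmx1.
Qed.

Lemma eff_resistance_augmented n (A : 'M[R]_n) i j : weight_matrix A ->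
  irreducible_laplacian A ->
  eff_resistance (loopy_laplacian A) i j =
    eff_resistance (augmented_laplacian A) (lshift 1 i) (lshift 1 j).
Proof.
move=> hA hirr; have [x Qx] := loopy_laplacian_solve i j hA hirr.
rewrite (eff_resistanceE (loopy_laplacian_tr hA) Qx).
rewrite (eff_resistanceE (augmented_laplacian_tr hA) (augmented_laplacian_mul hA Qx)).
by rewrite !col_mxEu.
Qed.

End EffectiveResistance.

Theorem mainTheorem1 (R : realType) (k m : nat) (A : 'M[R]_(k + m))
    (hk : (2 <= k)%N) (hm : (0 < m)%N)
    (hA : weight_matrix A) (hirr : irreducible_laplacian A) :
  let Q := loopy_laplacian A in
  let L := loopless_laplacian A in
  [/\ forall i j : 'I_k,
        eff_resistance Q (lshift m i) (lshift m j)
          = eff_resistance (kron_reduction Q) i j,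
      strictly_loopy A -> forall i j : 'I_(k + m),
        eff_resistance Q i j = diff_form (invmx Q) i j /\
        diff_form (invmx Q) i j
          = eff_resistance (augmented_laplacian A) (lshift 1 i) (lshift 1 j)
    & strictly_loopy A -> forall i j : 'I_(k + m),
        eff_resistance Q i j <= eff_resistance L i j].
Proof.
move=> Q L; split=> [i j|hs i j|_ i j].
- exact: eff_resistance_kron.
- have eQ : eff_resistance Q i j = diff_form (invmx Q) i j.
    apply: eff_resistance_invmx; first exact: loopy_laplacian_tr.
    exact: loopy_laplacian_unit.
  by split=> //; rewrite -eQ; exact: eff_resistance_augmented.
- exact: eff_resistance_loopless_le.
Qed.
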